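(* Let $F:\mathbb{R}^d\to\mathbb{R}^d$ be $m$-strongly monotone and $L$-Lipschitz with $m,L>0$, let $\kappa=L/m$, and let $F(z^* )=0$. Suppose $F(z)=\mathbb{E}_\epsilon F(z;\epsilon)$ for all $z$, where the random operator $F(\cdot;\epsilon)$ satisfies the strong growth condition with parameter $\delta>0$: $$\mathbb{E}_\epsilon\|F(z;\epsilon)\|_2^2\le\delta\|F(z)\|_2^2\qquad\text{for all }z\in\mathbb{R}^d .$$ Let $(z_k)$ be generated from a deterministic $z_0$ by the stochastic gradient method $z_{k+1}=z_k-\eta F(z_k;\epsilon_k)$ with $\epsilon_0,\epsilon_1,\dots$ i.i.d. copies of $\epsilon$ and step size $\eta=1/(L\kappa\delta)$. Then for all $k\ge 0$ $$\mathbb{E}\|z_k-z^*\|_2^2\le\left(1-\frac{1}{\kappa^2\delta}\right)^k\|z_0-z^*\|_2^2 .$$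
   Context: $F$ is $m$-strongly monotone if $(F(z_1)-F(z_2))^\top(z_1-z_2)\ge m\|z_1-z_2\|_2^2$ for all $z_1,z_2\in\mathbb{R}^d$, and $L$-Lipschitz if $\|F(z_1)-F(z_2)\|_2\le L\|z_1-z_2\|_2$ for all $z_1,z_2\in\mathbb{R}^d$. *)

(* Defs.v *)
From HB Require Import structures.
From mathcomp Require Import all_boot all_order all_algebra finmap.
From mathcomp Require Import all_classical all_reals all_analysis.

Set Implicit Arguments.
Unset Strict Implicit.
Unset Printing Implicit Defensive.

Import Order.TTheory GRing.Theory Num.Theory.

Local Open Scope classical_set_scope.
Local Open Scope ring_scope.

Definition dotv (R : realType) (d : nat) (u v : 'cV[R]_d) : R :=
  \sum_(i < d) u i 0 * v i 0.

(* The library norm `|v| on matrices is the max norm, not the Euclidean one. *)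
Definition norm2 (R : realType) (d : nat) (v : 'cV[R]_d) : R :=
  Num.sqrt (dotv v v).

Definition strongly_monotone (R : realType) (d : nat) (m : R)
    (F : 'cV[R]_d -> 'cV[R]_d) : Prop :=
  forall z1 z2, m * norm2 (z1 - z2) ^+ 2 <= dotv (F z1 - F z2) (z1 - z2).

Definition lipschitz2 (R : realType) (d : nat) (L : R)
    (F : 'cV[R]_d -> 'cV[R]_d) : Prop :=
  forall z1 z2, norm2 (F z1 - F z2) <= L * norm2 (z1 - z2).

(* Joint measurability of (z, e) |-> Fs z e, with R^d carrying its Borel       *)
(* sigma-algebra. Column vectors have no measurable structure in the library;  *)
(* d.-tuple R has the product one, which is the Borel one, so z is entered     *)
(* through its tuple of coordinates and the values are tested coordinatewise.  *)
Definition random_operator (R : realType) (d : nat) (dE : measure_display)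
    (E : measurableType dE) (Fs : 'cV[R]_d -> E -> 'cV[R]_d) : Prop :=
  forall i : 'I_d,
    measurable_fun [set: (d.-tuple R * E)%type]
      (fun p : d.-tuple R * E => Fs (\col_j tnth p.1 j) p.2 i 0).

Definition mutually_independent (R : realType) (dT dE : measure_display)
    (T : measurableType dT) (E : measurableType dE) (P : probability T R)
    (X : nat -> {RV P >-> E}) : Prop :=
  forall (J : {fset nat}) (A : nat -> set E), (forall j, measurable (A j)) ->
    P (\bigcap_(j in [set` J]) (X j @^-1` A j)) =
    (\prod_(j <- J) P (X j @^-1` A j))%E.

(* Equality in law; X and Y may live on different probability spaces. *)
Definition same_law (R : realType) (dT dT' dE : measure_display)
    (T : measurableType dT) (T' : measurableType dT') (E : measurableType dE)
    (P : probability T R) (P' : probability T' R)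
    (X : {RV P >-> E}) (Y : {RV P' >-> E}) : Prop :=
  forall A : set E, measurable A -> distribution P X A = distribution P' Y A.

(* Main.v *)
Require Import Defs.
From HB Require Import structures.
From mathcomp Require Import all_boot all_order all_algebra finmap.
From mathcomp Require Import all_classical all_reals all_analysis.
From mathcomp Require Import measurable_realfun ring lra.

Set Implicit Arguments.
Unset Strict Implicit.
Unset Printing Implicit Defensive.

Import Order.TTheory GRing.Theory Num.Theory.

Local Open Scope classical_set_scope.
Local Open Scope ring_scope.

(** The squared distance to [zstar] contracts in expectation at every step.
    From a fixed point [x], expanding the square gives
    [|x - zstar|^2 - 2 eta <F x, x - zstar> + eta^2 E|Fs x epsilon|^2];
    strong monotonicity bounds the cross term, and strong growth followed by
    the Lipschitz bound (with [F zstar = 0]) bounds the last one.  The step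
    size [eta = m / (L^2 delta)] minimises the resulting factor
    [1 - 2 eta m + eta^2 delta L^2], whose minimum is
    [1 - 1 / (kappa^2 delta)] ([expected_step_contraction]).

    To use this at the random point [z k], one conditions on [z k], which is a
    function of [eps 0, ..., eps (k-1)] and hence independent of [eps k].
    Instead of handling generated sigma-algebras, [future_noise_independent]
    proves by induction on [k] that the current state is independent of every
    finite family of events on the noises of index at least [k]: the state at
    time [k.+1] is a measurable function of the pair (state, noise) at time
    [k], and agreement of two finite measures on rectangles propagates to all
    measurable sets of the product.  The law of the pair
    [(z k, eps k)] is thus a product measure, and Tonelli's theorem turns the
    expectation over it into an iterated integral
    ([expectation_independent_pair]) in which the fixed-point contraction
    bounds the inner integral. *)

(** * Independence of the state and of the future noise *)

Section independence.
Context (R : realType) (dT dS dE : measure_display) (T : measurableType dT)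
  (S : measurableType dS) (E : measurableType dE) (P : probability T R).

(** Two finite measures that agree on rectangles agree on the product
    sigma-algebra; here they are the law of [(X, Y)] restricted to [W] and the
    product law scaled by [P W].  Carrying the event [W] along is what lets the
    independence from the later noises survive the induction below. *)
Lemma joint_law_on_event (X : {RV P >-> S}) (Y : {RV P >-> E}) (W : set T) :
  measurable W ->
  (forall A B, measurable A -> measurable B ->
    P ((X @^-1` A `&` Y @^-1` B) `&` W) =
    (P (X @^-1` A) * P (Y @^-1` B) * P W)%E) ->
  forall C, measurable C ->
    P ((fun t => (X t, Y t)) @^-1` C `&` W) =
    ((distribution P X \x distribution P Y) C * P W)%E.
Proof.
move=> mW XYW C mC.
have mXY : measurable_fun setT (fun t => (X t, Y t)).
  by apply: measurable_fun_pair; exact: measurable_funPT.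
pose XY : {mfun T >-> (S * E)%type} :=
  HB.pack (fun t => (X t, Y t)) (isMeasurableFun.Build _ _ _ _ _ mXY).
have W0 : 0 <= fine (P W) by rewrite fine_ge0.
have WE : ((NngNum W0)%:num%:E = P W)%E by rewrite /= fineK// fin_num_measure.
pose m1 := distribution P X.
pose m2 := mscale (NngNum W0) (distribution P Y).
have -> : ((m1 \x distribution P Y) C * P W)%E = (m1 \x m2)%E C.
  rewrite /product_measure1/= muleC -WE -ge0_integralZl//=; last first.
    exact: measurable_fun_xsection.
apply: esym.
apply: (@product_measure_unique _ _ _ _ _ m1 m2 (pushforward (mrestr P mW) XY)) => // A B mA mB.
rewrite /pushforward /mrestr /m1 /m2 /mscale/= /distribution /pushforward.
transitivity (P ((X @^-1` A `&` Y @^-1` B) `&` W)) => //.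
rewrite XYW// -muleA; congr (_ * _)%E.
by rewrite [RHS](_ : _ = (NngNum W0)%:num%:E * P (Y @^-1` B))%E// WE muleC.
Qed.

(** The induction needs all the noises [j >= k] at once, not only [eps k]:
    passing from [k] to [k.+1] spends [eps k] on building the new state, and
    the noises that remain must still be jointly independent of it. *)
Lemma future_noise_independent (h : S * E -> S) (X : nat -> {RV P >-> S}) (s0 : S)
    (eps : nat -> {RV P >-> E}) :
  measurable_fun setT h ->
  mutually_independent eps ->
  (forall t, X 0%N t = s0) ->
  (forall k t, X k.+1 t = h (X k t, eps k t)) ->
  forall (k : nat) (J : {fset nat}) (B : set S) (A : nat -> set E),
    (forall j, j \in J -> (k <= j)%N) ->
    measurable B -> (forall j, measurable (A j)) ->
    P (X k @^-1` B `&` \bigcap_(j in [set` J]) eps j @^-1` A j) =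
    (P (X k @^-1` B) * P (\bigcap_(j in [set` J]) eps j @^-1` A j))%E.
Proof.
move=> mh indep X0 XS; elim=> [|k IH] J B A kJ mB mA.
  have [s0B|s0B] := pselect (B s0).
    have -> : X 0%N @^-1` B = setT by apply/seteqP; split=> t //= _; rewrite X0.
    by rewrite probability_setT mul1e setTI.
  have -> : X 0%N @^-1` B = set0 by apply/seteqP; split=> t //=; rewrite X0.
  by rewrite set0I measure0 mul0e.
have mC : measurable (h @^-1` B) by rewrite -[X in measurable X]setTI; exact: mh.
have mfut (K : {fset nat}) : measurable (\bigcap_(j in [set` K]) eps j @^-1` A j).
  apply: fin_bigcap_measurable => // j _.
  by rewrite -[X in measurable X]setTI; exact: measurable_funPT.
(* The induction hypothesis for the index set [k |` K], with [D2] as the event on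
   [eps k], factors rectangles in presence of the events indexed by [K]. *)
have rect (K : {fset nat}) : (forall j, j \in K -> (k < j)%N) ->
  forall D1 D2, measurable D1 -> measurable D2 ->
    P ((X k @^-1` D1 `&` eps k @^-1` D2) `&` \bigcap_(j in [set` K]) eps j @^-1` A j) =
    (P (X k @^-1` D1) * P (eps k @^-1` D2)
      * P (\bigcap_(j in [set` K]) eps j @^-1` A j))%E.
  move=> kK D1 D2 mD1 mD2.
  have kKN : k \notin K by apply/negP => /kK; rewrite ltnn.
  pose A' j := if j == k then D2 else A j.
  have A'K : \bigcap_(j in [set` K]) eps j @^-1` A' j =
             \bigcap_(j in [set` K]) eps j @^-1` A j.
    apply: eq_bigcapr => j /= jK; rewrite /A'; case: eqP => // jk.
    by move: kKN; rewrite -jk jK.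
  have mA' j : measurable (A' j) by rewrite /A'; case: ifP.
  have A'E : \bigcap_(j in [set` (k |` K)%fset]) eps j @^-1` A' j =
             eps k @^-1` D2 `&` \bigcap_(j in [set` K]) eps j @^-1` A j.
    by rewrite -A'K set_fsetU1 bigcap_setU1 {1}/A' eqxx.
  have PkK : (P (eps k @^-1` D2 `&` \bigcap_(j in [set` K]) eps j @^-1` A j) =
      P (eps k @^-1` D2) * P (\bigcap_(j in [set` K]) eps j @^-1` A j))%E.
    rewrite -A'E (indep _ _ mA') big_fsetU1//= -(indep _ _ mA') A'K.
    by rewrite /A' eqxx.
  rewrite -setIA -muleA -PkK -A'E; apply: IH => //.
  by move=> j; rewrite !inE => /orP[/eqP->//|/kK/ltnW].
have XE : X k.+1 @^-1` B = (fun t => (X k t, eps k t)) @^-1` (h @^-1` B).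
  by apply/seteqP; split=> t /=; rewrite XS.
rewrite XE (joint_law_on_event (mfut J) (rect J kJ) mC); congr (_ * _)%E.
(* With no remaining noise the same lemma identifies the product measure of
   [h @^-1` B] with the probability of the event on the left. *)
have := joint_law_on_event (mfut fset0) (rect fset0 _) mC.
by rewrite set_fset0 bigcap_set0 setIT probability_setT mule1 => ->.
Qed.

Corollary state_noise_independent (h : S * E -> S) (X : nat -> {RV P >-> S})
    (s0 : S) (eps : nat -> {RV P >-> E}) :
  measurable_fun setT h ->
  mutually_independent eps ->
  (forall t, X 0%N t = s0) ->
  (forall k t, X k.+1 t = h (X k t, eps k t)) ->
  forall k A B, measurable A -> measurable B ->
    P (X k @^-1` A `&` eps k @^-1` B) =
    (P (X k @^-1` A) * P (eps k @^-1` B))%E.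
Proof.
move=> mh indep X0 XS k A B mA mB.
have := future_noise_independent mh indep X0 XS (k := k) (J := [fset k]%fset)
  (B := A) (A := fun=> B).
by rewrite set_fset1 bigcap_set1; apply => // j; rewrite inE => /eqP->.
Qed.

(** The inner integral is the conditional expectation of [g (X, Y)] given
    [X]: independence allows [X] to be frozen while [Y] is averaged. *)
Lemma expectation_independent_pair (X : {RV P >-> S}) (Y : {RV P >-> E})
    (g : S * E -> \bar R) :
  (forall A B, measurable A -> measurable B ->
    P (X @^-1` A `&` Y @^-1` B) = (P (X @^-1` A) * P (Y @^-1` B))%E) ->
  measurable_fun setT g -> (forall p, 0 <= g p)%E ->
  (\int[P]_t g (X t, Y t) =
   \int[P]_t \int[distribution P Y]_e g (X t, e))%E.
Proof.
move=> XY mg g0.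
have mXY : measurable_fun setT (fun t => (X t, Y t)).
  by apply: measurable_fun_pair; exact: measurable_funPT.
pose XYf : {mfun T >-> (S * E)%type} :=
  HB.pack (fun t => (X t, Y t)) (isMeasurableFun.Build _ _ _ _ _ mXY).
transitivity (\int[distribution P XYf]_p g p)%E.
  by rewrite ge0_integral_pushforward//= ?preimage_setT.
rewrite (eq_measure_integral (distribution P X \x distribution P Y)%E); last first.
  move=> C mC _; have := @joint_law_on_event X Y setT measurableT _ C mC.
  rewrite setIT probability_setT mule1; apply => A B mA mB.
  by rewrite setIT mule1 XY.
rewrite fubini_tonelli1//= ge0_integral_pushforward//= ?preimage_setT//.
- exact: measurable_fun_fubini_tonelli_F.
- by move=> x _; apply: integral_ge0.
Qed.

End independence.

(** * Contraction of one step from a fixed point *)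

Section euclidean.
Context (R : realType) (d : nat).
Implicit Types u v : 'cV[R]_d.

Lemma sqr_norm2 v : norm2 v ^+ 2 = dotv v v.
Proof. by rewrite sqr_sqrtr// sumr_ge0// => i _; rewrite -expr2 sqr_ge0. Qed.

Lemma dotvC u v : dotv u v = dotv v u.
Proof. by apply: eq_bigr => i _; rewrite mulrC. Qed.

Lemma sqr_norm2_subZ (a : R) u v :
  norm2 (u - a *: v) ^+ 2 =
  norm2 u ^+ 2 - 2 * a * dotv u v + a ^+ 2 * norm2 v ^+ 2.
Proof.
rewrite !sqr_norm2 /dotv !mulr_sumr -sumrN -!big_split/=.
by apply: eq_bigr => i _; rewrite !mxE; ring.
Qed.

Lemma measurable_sqr_norm2 (dT : measure_display) (T : measurableType dT)
    (f : T -> 'cV[R]_d) :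
  (forall i, measurable_fun setT (fun t => f t i 0)) ->
  measurable_fun setT (fun t => norm2 (f t) ^+ 2).
Proof.
move=> mf; under eq_fun do rewrite sqr_norm2.
by apply: measurable_sum => i; exact: measurable_funM.
Qed.

End euclidean.

Section one_step.
Context (R : realType) (d : nat).

(** The finite means make each coordinate of [Y] integrable and the bound [s]
    makes [|Y|^2] integrable, so the expansion of the square can be integrated
    term by term. *)
Lemma expected_sqr_dist (dT : measure_display) (T : measurableType dT)
    (P : probability T R) (Y : T -> 'cV[R]_d) (u g : 'cV[R]_d) (a s : R) :
  (forall i, measurable_fun setT (fun t => Y t i 0)) ->
  (forall i, \int[P]_t (Y t i 0)%:E = (g i 0)%:E)%E ->
  (\int[P]_t (norm2 (Y t) ^+ 2)%:E <= s%:E)%E ->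
  (\int[P]_t (norm2 (u - a *: Y t) ^+ 2)%:E
    <= (norm2 u ^+ 2 - 2 * a * dotv u g + a ^+ 2 * s)%:E)%E.
Proof.
move=> mY Yg Ys.
have iY i : P.-integrable setT (fun t => (Y t i 0)%:E).
  apply/integrableP; split; first exact/measurable_EFinP.
  by rewrite integral_fin_num_abs// Yg.
have mY2 : measurable_fun setT (fun t => norm2 (Y t) ^+ 2).
  exact: measurable_sqr_norm2.
have iY2 : P.-integrable setT (fun t => (norm2 (Y t) ^+ 2)%:E).
  apply/integrableP; split; first exact/measurable_EFinP.
  under eq_integral do rewrite gee0_abs ?lee_fin ?sqr_ge0//.
  exact: le_lt_trans Ys (ltry _).
have iuY : P.-integrable setT (fun t => \sum_(i < d) ((u i 0)%:E * (Y t i 0)%:E))%E.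
  by apply: integrable_sum => // i _; exact: integrableZl.
have iconst : P.-integrable setT (cst (norm2 u ^+ 2)%:E).
  exact: finite_measure_integrable_cst.
have -> : (fun t => (norm2 (u - a *: Y t) ^+ 2)%:E) =
  (fun t => (norm2 u ^+ 2)%:E
    + ((- (2 * a))%:E * (\sum_(i < d) ((u i 0)%:E * (Y t i 0)%:E))
    + (a ^+ 2)%:E * (norm2 (Y t) ^+ 2)%:E))%E.
  apply/funext => t; under eq_bigr do rewrite -EFinM.
  rewrite sumEFin -!EFinM -!EFinD sqr_norm2_subZ; congr (_%:E).
  by rewrite /dotv; ring.
rewrite integralD//=; last 1 first.
  by apply: integrableD => //; exact: integrableZl.
rewrite integralD//=; [|exact: integrableZl|exact: integrableZl].
rewrite !integralZl// integral_cst//= probability_setT mule1.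
rewrite integral_sum//=; last by move=> i; exact: integrableZl.
under eq_bigr => i _ do rewrite integralZl// Yg -EFinM.
rewrite sumEFin -addrA EFinD leeD2l// EFinD leeD//.
  by rewrite -EFinM lee_fin mulNr.
by rewrite [leRHS]EFinM lee_wpmul2l// lee_fin sqr_ge0.
Qed.

(** With [eta = m / (L^2 delta)] one has [eta^2 delta L^2 = eta m], so the
    quadratic term costs half of the gain [2 eta m] of the cross term, and
    [eta m = 1 / (kappa^2 delta)] is what remains. *)
Lemma strongly_monotone_descent (m L kappa delta eta : R)
    (F : 'cV[R]_d -> 'cV[R]_d) (zstar x : 'cV[R]_d) :
  0 < m -> 0 < L -> 0 < delta ->
  kappa = L / m -> eta = 1 / (L * kappa * delta) ->
  strongly_monotone m F -> lipschitz2 L F -> F zstar = 0 ->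
  norm2 (x - zstar) ^+ 2 - 2 * eta * dotv (x - zstar) (F x)
    + eta ^+ 2 * (delta * norm2 (F x) ^+ 2)
  <= (1 - 1 / (kappa ^+ 2 * delta)) * norm2 (x - zstar) ^+ 2.
Proof.
move=> m0 L0 delta0 kE etaE Fm FL Fz.
have := Fm x zstar; have := FL x zstar; rewrite Fz subr0 dotvC.
set N := norm2 _; set M := norm2 (_ - _); set D := dotv _ _ => NM MD.
have N0 : 0 <= N by exact: sqrtr_ge0.
have N2 : N ^+ 2 <= L ^+ 2 * M ^+ 2 by rewrite -exprMn ler_pXn2r// nnegrE (le_trans N0).
have eta0 : 0 < eta by rewrite etaE kE !(divr_gt0,mulr_gt0).
have kE2 : 1 / (kappa ^+ 2 * delta) = eta * m.
  rewrite etaE kE; field; rewrite ?gt_eqF//.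
have eE : eta ^+ 2 * (delta * (L ^+ 2 * M ^+ 2)) = eta * m * M ^+ 2.
  rewrite etaE kE; field; rewrite ?gt_eqF//.
rewrite kE2.
have H1 : eta ^+ 2 * (delta * N ^+ 2) <= eta * m * M ^+ 2.
  by rewrite -eE !ler_wpM2l ?sqr_ge0// ltW.
have H2 : eta * (m * M ^+ 2) <= eta * D by rewrite ler_wpM2l// ltW.
lra.
Qed.

End one_step.

(** * The iteration as a measurable recursion on tuples *)

Section coordinates.
Context (R : realType) (d : nat).

(** The state of the recursion is the tuple of coordinates of the iterate, on
    which [random_operator] expresses joint measurability. *)
Definition vec_of_tuple (t : d.-tuple R) : 'cV[R]_d := \col_j tnth t j.

Definition tuple_of_vec (v : 'cV[R]_d) : d.-tuple R := [tuple v j 0 | j < d].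

Lemma tuple_of_vecK : cancel tuple_of_vec vec_of_tuple.
Proof. by move=> v; apply/colP => j; rewrite mxE tnth_mktuple. Qed.

Lemma measurable_vec_of_tuple i :
  measurable_fun setT (fun t : d.-tuple R => vec_of_tuple t i 0).
Proof. by under eq_fun do rewrite mxE; exact: measurable_tnth. Qed.

Context (dE : measure_display) (E : measurableType dE)
  (Fs : 'cV[R]_d -> E -> 'cV[R]_d) (eta : R).
Hypothesis mFs : random_operator Fs.

Definition sgd_step (p : d.-tuple R * E) : d.-tuple R :=
  tuple_of_vec (vec_of_tuple p.1 - eta *: Fs (vec_of_tuple p.1) p.2).

Lemma measurable_sgd_step_coord i : measurable_fun setT
  (fun p : d.-tuple R * E =>
     (vec_of_tuple p.1 - eta *: Fs (vec_of_tuple p.1) p.2) i 0).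
Proof.
under eq_fun do rewrite !mxE.
apply: measurable_funB.
  exact: (measurableT_comp (@measurable_tnth _ _ _ i) measurable_fst).
exact: measurable_funM (measurable_cst _) (mFs i).
Qed.

Lemma measurable_sgd_step : measurable_fun setT sgd_step.
Proof.
apply/measurable_fun_tnthP => i.
rewrite (_ : _ \o _ = fun p : d.-tuple R * E =>
  (vec_of_tuple p.1 - eta *: Fs (vec_of_tuple p.1) p.2) i 0).
  exact: measurable_sgd_step_coord.
by apply/funext => p /=; rewrite tnth_mktuple.
Qed.

Lemma measurable_random_operator (x : 'cV[R]_d) i :
  measurable_fun setT (fun e => Fs x e i 0).
Proof.
have := measurable_fun_pair2 (tuple_of_vec x) (mFs i).
by under eq_fun do rewrite -/(vec_of_tuple _) tuple_of_vecK.
Qed.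

End coordinates.

(** * Contraction of the expected squared distance *)

Lemma expected_step_contraction (R : realType) (d : nat)
    (dE dT0 : measure_display) (E : measurableType dE)
    (T0 : measurableType dT0) (P0 : probability T0 R)
    (F : 'cV[R]_d -> 'cV[R]_d) (Fs : 'cV[R]_d -> E -> 'cV[R]_d)
    (epsilon : {RV P0 >-> E}) (m L kappa delta eta : R) (zstar : 'cV[R]_d) :
  0 < m -> 0 < L -> 0 < delta ->
  kappa = L / m ->
  eta = 1 / (L * kappa * delta) ->
  strongly_monotone m F ->
  lipschitz2 L F ->
  F zstar = 0 ->
  random_operator Fs ->
  (forall (x : 'cV[R]_d) (i : 'I_d),
    ('E_P0[fun w => (Fs x (epsilon w) i 0)%R] = (F x i 0)%R%:E)%E) ->
  (forall x : 'cV[R]_d,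
    ('E_P0[fun w => (norm2 (Fs x (epsilon w)) ^+ 2)%R]
       <= (delta * norm2 (F x) ^+ 2)%R%:E)%E) ->
  forall x : 'cV[R]_d,
    (\int[P0]_w (norm2 (x - eta *: Fs x (epsilon w) - zstar) ^+ 2)%:E
      <= ((1 - 1 / (kappa ^+ 2 * delta)) * norm2 (x - zstar) ^+ 2)%:E)%E.
Proof.
move=> m0 L0 delta0 kE etaE Fm FL Fz mFs EFs EFs2 x.
under eq_integral do rewrite addrAC.
apply: (@le_trans _ _ (norm2 (x - zstar) ^+ 2
    - 2 * eta * dotv (x - zstar) (F x)
    + eta ^+ 2 * (delta * norm2 (F x) ^+ 2))%:E); last first.
  by rewrite lee_fin; exact: (@strongly_monotone_descent _ _ m L).
apply: expected_sqr_dist => [i|i|].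
- apply: (measurableT_comp (measurable_random_operator mFs x i)).
  exact: measurable_funPT.
- by have := EFs x i; rewrite unlock.
- by have := EFs2 x; rewrite unlock.
Qed.

Theorem theorem7 (R : realType) (d : nat)
    (dE dT0 dT : measure_display) (E : measurableType dE)
    (T0 : measurableType dT0) (T : measurableType dT)
    (P0 : probability T0 R) (P : probability T R)
    (F : 'cV[R]_d -> 'cV[R]_d) (Fs : 'cV[R]_d -> E -> 'cV[R]_d)
    (epsilon : {RV P0 >-> E}) (eps : nat -> {RV P >-> E})
    (m L kappa delta eta : R) (zstar z0 : 'cV[R]_d)
    (z : nat -> T -> 'cV[R]_d) :
  0 < m -> 0 < L -> 0 < delta ->
  kappa = L / m ->
  eta = 1 / (L * kappa * delta) ->
  strongly_monotone m F ->
  lipschitz2 L F ->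
  F zstar = 0 ->
  random_operator Fs ->
  (forall (x : 'cV[R]_d) (i : 'I_d),
    ('E_P0[fun w => (Fs x (epsilon w) i 0)%R] = (F x i 0)%R%:E)%E) ->
  (forall x : 'cV[R]_d,
    ('E_P0[fun w => (norm2 (Fs x (epsilon w)) ^+ 2)%R]
       <= (delta * norm2 (F x) ^+ 2)%R%:E)%E) ->
  mutually_independent eps ->
  (forall k, same_law (eps k) epsilon) ->
  (forall w, z 0%N w = z0) ->
  (forall k w, z k.+1 w = z k w - eta *: Fs (z k w) (eps k w)) ->
  forall k : nat,
    ('E_P[fun w => (norm2 (z k w - zstar) ^+ 2)%R]
       <= ((1 - 1 / (kappa ^+ 2 * delta)) ^+ k * norm2 (z0 - zstar) ^+ 2)%R%:E)%E.
Proof.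
move=> m0 L0 delta0 kE etaE Fm FL Fz mFs EFs EFs2 indep law zinit zS.
set q := 1 - _.
have contr x : (\int[P0]_w (norm2 (x - eta *: Fs x (epsilon w) - zstar) ^+ 2)%:E
    <= (q * norm2 (x - zstar) ^+ 2)%:E)%E.
  exact: (expected_step_contraction m0 L0 delta0 kE etaE Fm FL Fz mFs EFs EFs2).
have q0 x : 0 <= q * norm2 (x - zstar) ^+ 2.
  rewrite -lee_fin; apply: le_trans (contr x).
  by apply: integral_ge0 => w _; rewrite lee_fin sqr_ge0.
pose h := sgd_step Fs eta.
have mh : measurable_fun setT h by exact: measurable_sgd_step.
have hS k w : tuple_of_vec (z k.+1 w) = h (tuple_of_vec (z k w), eps k w).
  by rewrite /h /sgd_step/= tuple_of_vecK zS.
have mZ k : measurable_fun setT (fun w => tuple_of_vec (z k w)).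
  elim: k => [|k IH].
    by under eq_fun do rewrite zinit; exact: measurable_cst.
  under eq_fun do rewrite hS.
  apply: (measurableT_comp mh); apply: measurable_fun_pair => //.
pose Z k : {RV P >-> d.-tuple R} :=
  HB.pack (fun w => tuple_of_vec (z k w)) (isMeasurableFun.Build _ _ _ _ _ (mZ k)).
have ZK k w : vec_of_tuple (Z k w) = z k w by exact: tuple_of_vecK.
have mdist k : measurable_fun setT (fun w => norm2 (z k w - zstar) ^+ 2).
  apply: measurable_sqr_norm2 => i; under eq_fun do rewrite !mxE -ZK.
  apply: measurable_funB => //.
  exact: (measurableT_comp (measurable_vec_of_tuple i) (mZ k)).
have Zindep k := @state_noise_independent _ _ _ _ _ _ _ P h Z (tuple_of_vec z0) eps
  mh indep (fun w => congr1 _ (zinit w)) hS k.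
rewrite unlock.
have step k : (\int[P]_w (norm2 (z k.+1 w - zstar) ^+ 2)%:E
    <= \int[P]_w (q * norm2 (z k w - zstar) ^+ 2)%:E)%E.
  pose g (p : d.-tuple R * E) : \bar R := (norm2 (vec_of_tuple p.1
    - eta *: Fs (vec_of_tuple p.1) p.2 - zstar) ^+ 2)%:E.
  have mg : measurable_fun setT g.
    apply/measurable_EFinP/measurable_sqr_norm2 => i.
    under eq_fun do rewrite mxE.
    by apply: measurable_funD => //; exact: measurable_sgd_step_coord.
  have g0 p : (0 <= g p)%E by rewrite lee_fin sqr_ge0.
  have -> : (\int[P]_w (norm2 (z k.+1 w - zstar) ^+ 2)%:E =
      \int[P]_w g (Z k w, eps k w))%E.
    by apply: eq_integral => w _; rewrite /g/= ZK zS.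
  rewrite (expectation_independent_pair (Zindep k) mg g0).
  apply: ge0_le_integral => //.
  - by move=> w _; exact: integral_ge0.
  - apply: (measurableT_comp (measurable_fun_fubini_tonelli_F g mg g0)).
    exact: mZ.
  - exact/measurable_EFinP/measurable_funM.
  move=> w _; rewrite (eq_measure_integral (distribution P0 epsilon)); last first.
    by move=> A mA _; exact: law.
  rewrite ge0_integral_pushforward//=.
    by rewrite preimage_setT /g /= ZK; exact: contr.
  by apply: (measurable_fun_pair2 (Z k w) mg).
elim=> [|k IH].
  under eq_integral do rewrite zinit.
  by rewrite integral_cst//= probability_setT mule1 expr0 mul1r.
apply: le_trans (step k) _.
(* Nothing forces [0 <= q] when [d = 0]; but by [q0] a negative [q] makes every
   distance to [zstar] vanish, so both sides are zero. *)
have [qneg|qpos] := ltP q 0.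
  have nz x : norm2 (x - zstar) ^+ 2 = 0.
    apply/eqP; rewrite eq_le sqr_ge0 andbT.
    by have := q0 x; rewrite nmulr_rge0.
  under eq_integral do rewrite nz mulr0.
  by rewrite integral0 nz mulr0.
under eq_integral do rewrite EFinM.
rewrite ge0_integralZl_EFin//.
- by rewrite exprS -mulrA EFinM lee_wpmul2l// lee_fin.
- by move=> w _; rewrite lee_fin sqr_ge0.
exact/measurable_EFinP/mdist.
Qed.
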